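(* Let $e : X \to Y$ be a compactification of a completely regular space $X$ and $\alpha = e^\flat : C(Y) \to B(X)$, $e^\flat(f)=f\circ e$, the corresponding basic extension. Then $X$ is locally compact iff $\alpha(b) = \bigvee \{ \alpha(a) \mid a \in I_\alpha, a \le b \}$ for all $0 \le b \in C(Y)$.
   Context: Completely regular spaces are Hausdorff. A compactification of a completely regular space $X$ is a topological embedding $e:X\to Y$ into a compact Hausdorff space $Y$ with $e[X]$ dense in $Y$. $C(Y)$ is the $\ell$-algebra (lattice-ordered $\mathbb R$-algebra) of continuous real-valued functions on $Y$, and $B(X)$ the $\ell$-algebra of all bounded real-valued functions on $X$, with pointwise operations and order. Real numbers are identified with constant functions. Joins of subsets of $B(X)$ are taken in $B(X)$ and presupposed to exist. An element $b\in B(X)$ is $\alpha$-compact if for every real $\varepsilon>0$ and every subset $T$ of nonnegative elements of $C(Y)$, $|b|+\varepsilon\le\bigvee\alpha[T]$ implies that there is a finite subset $T'$ of $T$ with $|b|\le\bigvee\alpha[T']$. An element $a\in C(Y)$ is $\alpha$-compact if $\alpha(a)$ is $\alpha$-compact, and $I_\alpha=\{a\in C(Y)\mid a\text{ is }\alpha\text{-compact}\}$. *)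

(* Defs.v *)
From HB Require Import structures.
From mathcomp Require Import all_boot all_order all_algebra finmap.
From mathcomp Require Import all_classical all_reals all_analysis.
Import Order.TTheory GRing.Theory Num.Theory.
Import numFieldNormedType.Exports.

Set Implicit Arguments.
Unset Strict Implicit.
Unset Printing Implicit Defensive.

Local Open Scope classical_set_scope.
Local Open Scope ring_scope.

(* [bfun X R] is the l-algebra B(X): its ring, module, order and lattice
   structures are all inherited from [X -> R], hence pointwise. *)
Section BoundedFunctions.
Variables (X : Type) (R : realType).
Implicit Types f g : X -> R.

Definition bounded_pred : {pred X -> R} := [pred f | `[< bounded_fun f >]].

Lemma bounded_predP f :
  reflect (exists M : R, forall x, `|f x| <= M) (f \in bounded_pred).
Proof.
apply: (iffP (asboolP _)) => [|[M fM]].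
  by move=> [M [_ fM]]; exists (M + 1) => x; apply: fM => //; rewrite ltrDl.
exists M; split; first exact: num_real.
by move=> N /ltW MN x _ /=; exact: le_trans (fM x) MN.
Qed.

Lemma bounded_pred_cst (c : R) : (fun=> c) \in bounded_pred.
Proof. by apply/bounded_predP; exists `|c|. Qed.

Lemma bounded_pred_subring : subring_closed bounded_pred.
Proof.
split=> [|f g /bounded_predP[M fM] /bounded_predP[N gN]|
          f g /bounded_predP[M fM] /bounded_predP[N gN]].
- exact: bounded_pred_cst.
- apply/bounded_predP; exists (M + N) => x.
  by rewrite (le_trans (ler_normB _ _)) ?lerD.
- apply/bounded_predP; exists (M * N) => x.
  by rewrite normrM ler_pM.
Qed.

Lemma bounded_pred_scale : GRing.scaler_closed bounded_pred.
Proof.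
move=> c f /bounded_predP[M fM]; apply/bounded_predP; exists (`|c| * M) => x.
by rewrite normrM ler_wpM2l.
Qed.

Lemma bounded_pred_meet : meet_closed bounded_pred.
Proof.
move=> f g /bounded_predP[M fM] /bounded_predP[N gN].
apply/bounded_predP; exists (Num.max M N) => x.
by rewrite meetfE meetEtotal le_max minElt; case: ifP; rewrite ?fM ?gN ?orbT.
Qed.

Lemma bounded_pred_join : join_closed bounded_pred.
Proof.
move=> f g /bounded_predP[M fM] /bounded_predP[N gN].
apply/bounded_predP; exists (Num.max M N) => x.
by rewrite joinfE joinEtotal le_max maxElt; case: ifP; rewrite ?fM ?gN ?orbT.
Qed.

HB.instance Definition _ :=
  GRing.isSubringClosed.Build (X -> R) bounded_pred bounded_pred_subring.
HB.instance Definition _ :=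
  GRing.isScaleClosed.Build R (X -> R) bounded_pred bounded_pred_scale.
HB.instance Definition _ :=
  Order.isLatticeClosed.Build _ (X -> R) bounded_pred
    bounded_pred_meet bounded_pred_join.

Definition bfun := {f : X -> R | f \in bounded_pred}.

HB.instance Definition _ := SubChoice.on bfun.
HB.instance Definition _ :=
  GRing.SubChoice_isSubComPzRing.Build (X -> R) bounded_pred bfun
    (GRing.subringClosedP bounded_pred).
HB.instance Definition _ := [SubZmodule_isSubLmodule of bfun by <:].
HB.instance Definition _ :=
  [SubChoice_isSubLattice of bfun by <: with ring_display].

Definition bcst (c : R) : bfun := Sub (fun=> c) (bounded_pred_cst c).

Definition babs (b : bfun) : bfun := (b `|` - b)%O.

Lemma babsE (b : bfun) x : val (babs b) x = `|val b x|.
Proof.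
rewrite /babs /= joinfE joinEtotal; set y := val b x.
change (Num.max y (- y) = `|y|).
have [y0|y0] := leP 0 y.
  by rewrite ger0_norm ?max_l ?ge0_cp.
by rewrite ltr0_norm ?max_r ?le0_cp ?ltW.
Qed.

Lemma bfun_leP (b c : bfun) : reflect (forall x, val b x <= val c x) (b <= c).
Proof. exact: lefP. Qed.

End BoundedFunctions.

(* [e] is a homeomorphism onto [range e] with the subspace topology. *)
Definition topological_embedding (X Y : topologicalType) (e : X -> Y) :=
  [/\ injective e, continuous e &
      forall U : set X, open U ->
        exists2 V : set Y, open V & e @` U = range e `&` V].

Record compactification (X Y : topologicalType) (e : X -> Y) : Prop := {
  compactification_compact : compact [set: Y];
  compactification_hausdorff : hausdorff_space Y;
  compactification_embedding : topological_embedding e;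
  compactification_dense : dense (range e) }.

Section Flat.
Variables (R : realType) (X Y : topologicalType) (e : X -> Y).
Hypothesis he : compactification e.

Lemma comp_bounded (f : continuousType Y R) : f \o e \in @bounded_pred X R.
Proof.
have /compact_bounded[M [_ fM]] : compact (f @` [set: Y]).
  apply: continuous_compact; last exact: compactification_compact he.
  exact/continuous_subspaceT/cts_fun.
apply/bounded_predP; exists (M + 1) => x.
by apply: fM; [rewrite ltrDl | exists (e x)].
Qed.

Definition flat (f : continuousType Y R) : bfun X R :=
  Sub (f \o e) (comp_bounded f).

End Flat.

Section AlphaCompact.
Variables (R : realType) (X Y : topologicalType).
Variable alpha : continuousType Y R -> bfun X R.

(* An inequality between an element of B(X) and a join includes the existence
   of the join in B(X); in particular, if X is nonempty, then the empty set has
   no join, as B(X) has no least element. *)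
Definition alpha_compact (b : bfun X R) :=
  forall (eps : R) (T : set (continuousType Y R)),
    0 < eps -> (forall t, T t -> forall y, 0 <= t y) ->
    forall s, isLub (alpha @` T) s -> babs b + bcst X eps <= s ->
    exists T' : set (continuousType Y R), [/\ T' `<=` T, finite_set T' &
      exists2 s', isLub (alpha @` T') s' & babs b <= s'].

Definition Ialpha : set (continuousType Y R) := [set a | alpha_compact (alpha a)].

End AlphaCompact.

(* Main.v *)
From HB Require Import structures.
Require Import Defs.
From mathcomp Require Import all_boot all_order all_algebra.
From mathcomp Require Import all_classical all_reals all_analysis.
From mathcomp Require Import lra.
Import Order.TTheory GRing.Theory Num.Theory.
Import numFieldNormedType.Exports.

Local Open Scope classical_set_scope.
Local Open Scope ring_scope.

(* A function in C(Y) whose restriction to X vanishes off a compact subset of X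
   is alpha-compact, by a covering argument; multiplying b by Urysohn functions
   supported near a point of X then exhibits b as a join of such functions.
   Conversely, if a is alpha-compact and c > 0, then the closure in Y of
   e[{a >= c}] lies in e[X]. Otherwise let y be a point of the closure outside
   e[X]: the nonnegative functions vanishing at y and bounded by a large
   constant N have join N, but finitely many of them are all small near y and
   cannot dominate |a|. So {a >= c} is compact, and the hypothesis for b = 1
   gives each point of X a neighbourhood of this form. *)

(** * Joins in [B(X)] are pointwise suprema *)

(** If [s] exceeded [M] at [x], lowering it to [M] at this single point would give a bounded upper
    bound not above [s]. *)
Lemma bfun_isLub_le {X : Type} {R : realType} {S : set (bfun X R)} {s : bfun X R}
    {x : X} {M : R} :
  isLub S s -> (forall f, S f -> val f x <= M) -> val s x <= M.
Proof.
move=> [us ls] SM.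
have [//|Ms] := leP (val s x) M.
pose c z := if `[< z = x >] then M else val s z.
have /bounded_predP[N sN] := valP s.
have bc : c \in @bounded_pred X R.
  apply/bounded_predP; exists (Num.max `|M| N) => z.
  by rewrite le_max /c; case: asboolP => _; rewrite ?lexx// sN orbT.
have : s <= (Sub c bc : bfun X R).
  apply: ls => f Sf; apply/bfun_leP => z; rewrite SubK /c.
  by case: asboolP => [->|_]; [exact: SM | exact: (bfun_leP _ _ (us _ Sf))].
by move=> /bfun_leP/(_ x); rewrite SubK /c asboolT// leNgt Ms.
Qed.

(** The pointwise supremum is bounded, as it lies between a member of [S] and [u]. *)
Lemma bfun_isLub_exists (X : Type) (R : realType) (S : set (bfun X R))
    (u : bfun X R) :
  S !=set0 -> ubound S u -> exists s, isLub S s.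
Proof.
move=> [f0 Sf0] uS.
pose E x := [set val f x | f in S].
have Eu x : ubound (E x) (val u x) by move=> _ [f Sf <-]; exact: (bfun_leP _ _ (uS _ Sf)).
have E0 x : E x !=set0 by exists (val f0 x), f0.
have Esup f x : S f -> val f x <= sup (E x).
  by move=> Sf; apply: ub_le_sup; [exists (val u x) | exists f].
have bs : (fun x => sup (E x)) \in @bounded_pred X R.
  have /bounded_predP[M uM] := valP u.
  have /bounded_predP[N fN] := valP f0.
  apply/bounded_predP; exists (Num.max M N) => x.
  have supu : sup (E x) <= val u x by exact: ge_sup.
  have fsup := Esup _ x Sf0.
  have := uM x; have := fN x; rewrite !ler_norml => /andP[? ?] /andP[? ?].
  have NM : N <= Num.max M N by rewrite le_max lexx orbT.
  have MM : M <= Num.max M N by rewrite le_max lexx.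
  by apply/andP; split; lra.
exists (Sub (fun x => sup (E x)) bs : bfun X R); split.
  by move=> f Sf; apply/bfun_leP => x; rewrite SubK; exact: Esup.
move=> c cS; apply/bfun_leP => x; rewrite SubK; apply: ge_sup => //.
by move=> _ [f Sf <-]; exact: (bfun_leP _ _ (cS _ Sf)).
Qed.

(** * Finite covers and Urysohn functions *)

Lemma near_finite_set (T I : Type) (F : set_system T) (D : set I)
    (P : I -> T -> Prop) : Filter F -> finite_set D ->
  (forall i, D i -> \forall x \near F, P i x) ->
  \forall x \near F, forall i, D i -> P i x.
Proof.
move=> FF /finite_setP[n]; elim: n D => [D|n IHn D /eq_cardSP[i Di Dn]] DP.
  by move: DP; rewrite II0 card_eq0 => /eqP -> _; exact: nearW.
have h := IHn _ Dn (fun j Dj => DP j (proj1 Dj)).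
near=> x => j Dj.
have [->|ij] := pselect (j = i); first by near: x; exact: DP.
by apply: (near h x) => //; split.
Unshelve. all: by end_near. Qed.

Lemma compact_finite_subcover (X : topologicalType) (I : Type) (K : set X)
    (D : set I) (U : I -> set X) :
  compact K -> (forall x, K x -> exists2 i, D i & nbhs x (U i)) ->
  exists D' : set I, [/\ D' `<=` D, finite_set D' & K `<=` \bigcup_(i in D') U i].
Proof.
move=> /compact_near_coveringP cK KU.
(* The filter of large finite subsets of [D]: near-covering compactness along it yields a single
   finite set of indices serving all of [K]. *)
pose F := filter_from [set A : set I | A `<=` D /\ finite_set A]
  (fun A => [set B : set I | [/\ B `<=` D, finite_set B & A `<=` B]]).
have FF : Filter F.
  apply: filter_from_filter; first by exists set0; split.
  move=> A B [AD fA] [BD fB]; exists (A `|` B).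
    by split; [rewrite subUset | rewrite finite_setU].
  by move=> C [CD fC]; rewrite subUset => -[AC BC]; split; split.
have [x Kx|A [AD fA] AK] := cK _ F (fun B x => (\bigcup_(i in B) U i) x) FF.
  have [i Di xU] := KU x Kx.
  exists (U i, [set B : set I | [/\ B `<=` D, finite_set B & [set i] `<=` B]]).
    split=> //; exists [set i] => //; split; last exact: finite_set1.
    by move=> _ ->.
  by move=> [z B] [/= Uz [_ _ iB]]; exists i => //; exact: iB.
by exists A; split => //; apply: AK; split.
Qed.

Definition mkcontinuous {R : realType} {Y : topologicalType} {f : Y -> R}
    (cf : continuous f) : continuousType Y R :=
  HB.pack f (isContinuous.Build Y R f cf).

Lemma Urysohn_point {R : realType} {Y : topologicalType} (y : Y) (B : set Y) :
  compact [set: Y] -> hausdorff_space Y -> closed B -> ~ B y ->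
  exists f : continuousType Y R,
    [/\ forall z, 0 <= f z <= 1, f y = 1 & forall z, B z -> f z = 0].
Proof.
move=> cY hY clB By.
have cly : closed [set y].
  exact/accessible_closed_set1/hausdorff_accessible.
have By0 : B `&` [set y] = set0.
  by rewrite -subset0 => z [Bz /= zy]; apply: By; rewrite -zy.
have /(@uniform_separatorP _ R)[f [cf f01 fB fy]] :=
  normal_uniform_separator (compact_normal hY cY) clB cly By0.
exists (mkcontinuous cf); split => /=.
- by move=> z; have /f01 := imageT f z; rewrite /= in_itv.
- by apply: fy; exists y.
- by move=> z Bz; apply: fB; exists z.
Qed.

(** * Cluster points and compactness through an embedding *)

Section TopologicalEmbedding.
Context {X Y : topologicalType} {e : X -> Y}.
Hypothesis he : topological_embedding e.

Lemma embedding_nbhs (x : X) (U : set X) :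
  nbhs x U -> exists2 V, open_nbhs (e x) V & e @^-1` V `<=` U.
Proof.
have [einj _ eopen] := he.
rewrite nbhsE => -[W [oW Wx] WU]; have [V oV eWV] := eopen W oW.
exists V.
  by split => //; have : (e @` W) (e x) by [exists x]; rewrite eWV => -[].
move=> z Vz; have : (e @` W) (e z) by rewrite eWV; split => //; exists z.
by move=> [w Ww /einj <-]; exact: WU.
Qed.

Lemma embedding_cluster (F : set_system X) (x : X) : Filter F ->
  cluster (e @ F) (e x) -> cluster F x.
Proof.
move=> FF cFx A B FA /embedding_nbhs[V [oV Vx] VB].
have [_ [[z Az <-] Vz]] : (e @` A) `&` V !=set0.
  apply: cFx; last exact: open_nbhs_nbhs.
  by apply: (@filterS _ _ _ A) FA => z Az; exists z.
by exists z; split => //; exact: VB.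
Qed.

Lemma embedding_compact (K : set X) : compact [set: Y] -> closed K ->
  closure (e @` K) `<=` range e -> compact K.
Proof.
move=> cY clK Ke F FF FK.
have [y [_ cFy]] := cY (e @ F) _ filterT.
have [x _ exy] : range e y.
  apply: Ke => V; apply: cFy.
  by apply: (@filterS _ _ _ K) FK => z Kz; exists z.
move: cFy; rewrite -exy => /embedding_cluster cFx.
by exists x; split => //; apply: clK => V; exact: cFx.
Qed.

End TopologicalEmbedding.

(** * Alpha-compact functions and compact subsets of [X] *)

Section BasicExtension.
Context {R : realType} {X Y : topologicalType} {e : X -> Y}.
Hypothesis he : compactification e.

Lemma compact_support_Ialpha {a : continuousType Y R} {K : set X} (x0 : X) :
  compact K -> (forall x, ~ K x -> a (e x) = 0) -> Ialpha (flat he) a.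
Proof.
move=> cK aK eps T eps0 T0 s lubs as_.
(* The slack [eps] gives a strict inequality at each point, hence on a neighbourhood. *)
have Tgt x : exists2 t : continuousType Y R, T t & `|a (e x)| < t (e x).
  apply: contrapT => noT.
  have : val s x <= `|a (e x)|.
    apply: (bfun_isLub_le lubs) => _ [t Tt <-] /=.
    by rewrite leNgt; apply/negP => at_; apply: noT; exists t.
  have : val (babs (flat he a)) x + eps <= val s x := bfun_leP _ _ as_ x.
  by rewrite babsE /=; lra.
have [t0 Tt0 _] := Tgt x0.
have ce : continuous e by have [] := compactification_embedding he.
pose U (t : continuousType Y R) := [set x | `|a (e x)| < t (e x)].
have [T' [T'T fT' KT']] : exists T', [/\ T' `<=` T, finite_set T' &
    K `<=` \bigcup_(t in T') U t].
  apply: compact_finite_subcover => // x _; have [t Tt atx] := Tgt x.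
  exists t => //; rewrite /U.
  have cta : t (e z) - `|a (e z)| @[z --> x] --> t (e x) - `|a (e x)|.
    by apply: cvgB; [|apply: cvg_norm]; apply: continuous_comp;
      [exact: ce | exact: cts_fun | exact: ce | exact: cts_fun].
  have := cvgr_gt _ cta 0; rewrite subr_gt0 => /(_ _ atx).
  by apply: filterS => z; rewrite subr_gt0.
(* Adding [t0] keeps the family nonempty, so that its join exists even when [T'] is empty; as [t0]
   is nonnegative, it also dominates [a] off [K]. *)
exists (t0 |` T'); split.
- by move=> t [->//|/T'T].
- by rewrite finite_setU; split => //; exact: finite_set1.
have [s' lubs'] : exists s', isLub (flat he @` (t0 |` T')) s'.
  apply: (@bfun_isLub_exists _ _ _ s); first by exists (flat he t0), t0 => //; left.
  move=> _ [t tT' <-]; apply: (proj1 lubs); exists t => //.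
  by case: tT' => [->//|/T'T].
exists s' => //; apply/bfun_leP => x; rewrite babsE /=.
have s'ge t : (t0 |` T') t -> t (e x) <= val s' x.
  move=> tT'; apply: (bfun_leP (flat he t) s').
  by apply: (proj1 lubs'); exists t.
have [Kx|nKx] := pselect (K x).
  have [t T't /ltW atx] := KT' x Kx.
  by apply: le_trans atx (s'ge _ _); right.
by rewrite aK// normr0; apply: le_trans (T0 _ Tt0 _) (s'ge _ _); left.
Qed.

Lemma Ialpha_closure_range {a : continuousType Y R} {c : R} :
  Ialpha (flat he) a -> 0 < c ->
  closure (e @` [set x | c <= a (e x)]) `<=` range e.
Proof.
move=> Ia c0 y cly; apply: contrapT => ye.
have [cY hY emb _] := he.
have /bounded_predP[M aM] := valP (flat he a).
(* Chosen so that |a| + 1 <= N on [X], which is the premise of alpha-compactness with epsilon 1. *)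
pose N := M + 1.
pose T := [set t : continuousType Y R |
  (forall z, 0 <= t z <= N) /\ t y = 0].
(* As [y] is outside the range of [e], a Urysohn function separates it from [e x]; scale that
   function by [N]. *)
have TN x : exists2 t, T t & t (e x) = N.
  have [||f [f01 fx fy]] := @Urysohn_point R Y (e x) [set y] cY hY.
  - exact/accessible_closed_set1/hausdorff_accessible.
  - by move=> /= exy; apply: ye; exists x.
  have cNf : continuous (fun z => N * f z).
    by move=> z; apply: cvgM; [exact: cvg_cst | exact: cts_fun].
  have N0 : 0 <= N by rewrite addr_ge0// (le_trans _ (aM x)).
  exists (mkcontinuous cNf); rewrite /= ?fx ?mulr1//; split.
    move=> z /=; have /andP[f0 f1] := f01 z.
    by rewrite mulr_ge0// ler_piMr.
  by rewrite /= fy// mulr0.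
have lubN : isLub (flat he @` T) (bcst X N).
  split.
    move=> _ [t [tN _] <-]; apply/bfun_leP => x /=.
    by have /andP[] := tN (e x).
  move=> u uT; apply/bfun_leP => x /=.
  have [t Tt <-] := TN x.
  by apply: (bfun_leP (flat he t) u); apply: uT; exists t.
have [||T' [T'T fT' [s' lubs' as']]] := Ia 1 T ltr01 _ _ lubN.
- by move=> t [tN _] z; have /andP[] := tN z.
- apply/bfun_leP => x; change (val (babs (flat he a)) x + 1 <= N).
  by rewrite babsE lerD2r; exact: aM.
(* Finiteness of [T'] gives one neighbourhood of [y] for all its members. It contains some [e x]
   with [a (e x)] at least [c], where the join of [T'] is at most [c / 2]. *)
have : \forall z \near y, forall t, T' t -> t z < c / 2.
  apply: near_finite_set => // t /T'T[_ ty0].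
  apply: (cvgr_lt (t y)); first exact: cts_fun.
  by rewrite ty0 divr_gt0.
move=> /cly[_ [[x /= cx <-] T'c]].
have : val s' x <= c / 2.
  by apply: (bfun_isLub_le lubs') => _ [t T't <-]; exact/ltW/T'c.
have := bfun_leP _ _ as' x; rewrite babsE /=.
by have := ler_norm (a (e x)); lra.
Qed.

End BasicExtension.

Theorem theorem5p13 (R : realType) (X Y : topologicalType) (e : X -> Y)
    (X_cr : completely_regular_space X) (X_hausdorff : hausdorff_space X)
    (he : compactification e) :
  locally_compact [set: X] <->
  forall b : continuousType Y R, (forall y, 0 <= b y) ->
    isLub [set flat he a | a in
             [set a | Ialpha (flat he) a /\ (forall y, a y <= b y)]]
          (flat he b).
Proof.
have [cY hY emb _] := he; have [_ ce _] := emb.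
split=> [lcX b b0|joinX x _].
  split.
    by move=> _ [a [_ ab] <-]; apply/bfun_leP => x; exact: ab.
  move=> u uS; apply/bfun_leP => x /=.
  have [K + [cK clK]] := lcX x I.
  rewrite /within/= => xK.
  have [V [oV Vx] VK] : exists2 V, open_nbhs (e x) V & e @^-1` V `<=` K.
    by apply: embedding_nbhs => //; apply: filterS xK => z; apply.
  have [||f [f01 fx fV]] := @Urysohn_point R Y (e x) (~` V) cY hY.
  - exact: open_closedC.
  - by [].
  have cbf : continuous (fun z => b z * f z).
    by move=> z; apply: cvgM; exact: cts_fun.
  pose a : continuousType Y R := mkcontinuous cbf.
  (* The product [a] of [b] and [f] agrees with [b] at [e x], stays below [b], and vanishes on [X]
     off [K]. *)
  have -> : b (e x) = val (flat he a) x by rewrite /= fx mulr1.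
  apply: (bfun_leP (flat he a) u); apply: uS; exists a => //; split.
    apply: (compact_support_Ialpha he x cK) => z nKz /=.
    by rewrite fV ?mulr0// => Vz; exact/nKz/VK.
  by move=> z /=; have /andP[_ f1] := f01 z; rewrite ler_piMr.
pose one : continuousType Y R := mkcontinuous (@cst_continuous Y R 1).
have lub1 := joinX one (fun _ => ler01).
(* Any constant strictly between 0 and 1 would do: below 1 for such an [a] to exist, positive for
   [Ialpha_closure_range]. *)
have [a Ia ax] : exists2 a : continuousType Y R, Ialpha (flat he) a & 1/2 < a (e x).
  apply: contrapT => noa.
  have : val (flat he one) x <= 1/2.
    apply: (bfun_isLub_le lub1) => _ [a [Ia _] <-] /=.
    by rewrite leNgt; apply/negP => ax; apply: noa; exists a.
  by rewrite /=; lra.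
have cae : continuous (a \o e).
  by move=> z; apply: continuous_comp; [exact: ce | exact: cts_fun].
have clK : closed [set z | 1/2 <= a (e z)].
  exact: (iffLR (continuous_closedP _) cae _ (@closed_ge R (1/2))).
exists [set z | 1/2 <= a (e z)].
  rewrite /within/=; have : \forall z \near x, 1/2 < a (e z).
    by apply: (cvgr_gt (a (e x))) => //; exact: cae.
  by apply: filterS => z /ltW.
split => //; apply: (embedding_compact emb) => //.
by apply: (Ialpha_closure_range he Ia); lra.
Qed.
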